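(* Assume that $\operatorname{rank}\big([B_x]_{n_x+1:(N+1)n_x,\,1:Nn_u}\big)\ge n_x N$, where $[B_x]_{n_x+1:(N+1)n_x,\,1:Nn_u}$ is the submatrix of $B_x$ consisting of rows $n_x+1,\dots,(N+1)n_x$ and all columns. Consider the system $x_{t+1}=Ax_t+Bu_t+Cw_t$, $y_t=Dx_t+Ew_t$, a feasible state trajectory until time $t=k$ with $\hat x_{[k+1:k+N]}\in\mathbb{D}(x_k)$, and a control law defined by the cone program $(\mathrm{CP})$ given in the context. Then the constraints on the states for the next sampling time $t=k+1$, namely $e_m^\top x_i\le U_j$ for $i\in[t+1,t+N]$, for all $j\le N_b$ and all $m\in\mathbb{I}_m$, are guaranteed for every realization $w_k\in\mathbb{W}$; i.e. the set of feasible states is nonempty: $\mathbb{D}(x_{k+1})\neq\emptyset$.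
   Context: System: $x_{t+1}=Ax_t+Bu_t+Cw_t$, $y_t=Dx_t+Ew_t$, with $x_t\in\mathbb{R}^{n_x}$, $u_t\in\mathbb{R}^{n_u}$, $y_t\in\mathbb{R}^{n_y}$, $w_t\in\mathbb{R}^{n_w}$; the disturbance $w_t$ is an i.i.d. random process with known mean and covariance, and $\mathbb{W}$ is the set of possible disturbance values. $N$ is the prediction horizon. The following optimization is posed at each sampling time $k$ with initial state $x=x_k$. Control laws: let $\hat y$ be the output of the nominal model $\hat x_{t+1}=A\hat x_t+Bu_t$, $\hat y_t=D\hat x_t$, started at $0$ at the beginning of the window, and $v_t=y_t-\hat y_t$. A purified-output-based affine control law is $u_t=h_t+\sum_{\tau=k}^tH_{t,\tau}v_\tau$, $t\in[k,k+N-1]$, collected in $H_N=[\,h\ \ H\,]\in\mathbb{R}^{Nn_u\times(1+Nn_y)}$, with $h$ the stacked $h_t$ and $H$ block lower triangular. Stacked form: $\xi=w_{[k:k+N-1]}\in\mathbb{R}^{n_\xi}$, $n_\xi=Nn_w$, $\tilde w=(1,\xi^\top)^\top$. Write $x_{[k:k+N]}=A_xx+B_xu_{[k:k+N-1]}+C_x\xi$ and $y_{[k:k+N-1]}=A_yx+B_yu_{[k:k+N-1]}+(C_y+E_y)\xi$ for the stacked dynamics and outputs obtained by iterating the system (subscripts $[a:b]$ denote vertical concatenation over times $a,\dots,b$; the first $n_x$ rows of $B_x$ are zero; $E_y=\operatorname{diag}(E,\dots,E)$). Put $\tilde C_x=[A_xx\ \ C_x]$, $\tilde C_y=\begin{bmatrix}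 0 & 0 \\ A_y x & C_y \end{bmatrix}$, $\tilde E_y=\begin{bmatrix} 1 & 0 \\ 0 & E_y \end{bmatrix}$, $\tilde H_N=H_N(\tilde C_y+\tilde E_y)$; then $u_{[k:k+N-1]}=\tilde H_N\tilde w$ and $x_{[k:k+N]}=(B_x\tilde H_N+\tilde C_x)\tilde w$. Ambiguity set: $\Xi=\{\xi\in\mathbb{R}^{n_\xi}:C_\xi\xi\le d_\xi\}$ is a polytope, $\mathcal{M}(\Xi)$ the set of probability distributions on $\Xi$ with finite expected norm, $d_{\mathrm W}$ the type-1 Wasserstein metric for a norm $\|\cdot\|$ (dual norm $\|\cdot\|_*$), i.e. $d_{\mathrm W}(\mathbb{Q}_1,\mathbb{Q}_2)$ is the infimum of $\int\|\xi_1-\xi_2\|\,\Pi(\mathrm d\xi_1,\mathrm d\xi_2)$ over joint distributions $\Pi$ with marginals $\mathbb{Q}_1,\mathbb{Q}_2$. $\widehat{\mathbb{P}}_{N_s}=\frac1{N_s}\sum_{i=1}^{N_s}\delta_{\widehat\xi_i}$ is the empirical distribution of $N_s$ samples $\widehat\xi_i\in\Xi$ (each a disturbance sequence of length $N$), and $\mathbb{B}_\varepsilon(\widehat{\mathbb{P}}_{N_s})=\{\mathbb{Q}\in\mathcal{M}(\Xi):d_{\mathrm W}(\widehat{\mathbb{P}}_{N_s},\mathbb{Q})\le\varepsilon\}$, $\varepsilon>0$. Constraints: $\mathbb{I}_m$ is the index set of constrained state components; $e_m$ is the $m$-th unit vector. The $j$-th of the $N_b$ constraints, $e_m^\top x_i\le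 U_j$, bounds the corresponding component $m=m(j)\in\mathbb{I}_m$ of all predicted states by $U_j$. In the optimal control problem posed at time $k$ the constraints enter in the distributionally robust form $$\sup_{\mathbb{Q}\in\mathbb{B}_\varepsilon(\widehat{\mathbb{P}}_{N_s})}\mathbb{E}^{\mathbb{Q}}[\ell_j(\xi,H_N)]\le U_j,\qquad \ell_j(\xi,H_N)=\max_{i\in[k+1,k+N]}e_{m(j)}^\top x_i,\qquad j\le N_b.$$ $\mathbb{D}(x_k)$ denotes the set of feasible state trajectories within the prediction horizon $N$ with initial state $x_k$ (feasible for this optimal control problem). Cone program $(\mathrm{CP})$ at initial state $x$ (the reformulation of the optimal control problem): minimize over $H_N,\lambda_j,s_{ij},\gamma_{ijt}$ the cost $\operatorname{Tr}\{M\Sigma_w\}+\mu_w^\top M\mu_w$, with $M=(\tilde C_x+B_x\tilde H_N)^\top J_x(\tilde C_x+B_x\tilde H_N)+\tilde H_N^\top J_u\tilde H_N$, subject to, for all $i\le N_s$, $j\le N_b$, $1\le t\le N$, $$\lambda_j\varepsilon+\tfrac1{N_s}\sum_{i=1}^{N_s}s_{ij}\le U_j,\quad b_{tj}+\langle a_{tj},\widehat\xi_i\rangle+\langle\gamma_{ijt},d_\xi-C_\xi\widehat\xi_i\rangle\le s_{ij},\quad \|C_\xi^\top\gamma_{ijt}-a_{tj}\|_*\le\lambda_j,\quad\gamma_{ijt}\ge0,$$ where $(b_{tj},a_{tj})$ is the row of $B_x\tilde H_N+\tilde C_x$ with index $tn_x+m(j)$ (first entry $b_{tj}$, remaining entries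 $a_{tj}$). Here $\mu_w,\Sigma_w$ are the mean and covariance of $\tilde w$, $J_x=\operatorname{diag}(\operatorname{diag}(\beta^0,\dots,\beta^{N-1})\otimes Q,\beta^NQ_f)$, $J_u=\operatorname{diag}(\beta^0,\dots,\beta^{N-1})\otimes R$, $\beta\in(0,1]$, $Q,Q_f$ positive semidefinite, $R$ positive definite. *)

(* Defs.v *)
From HB Require Import structures.
From mathcomp Require Import all_boot all_order all_algebra.
From mathcomp Require Import all_classical all_reals all_analysis.
From mathcomp Require Export mxtens.

Set Implicit Arguments.
Unset Strict Implicit.
Unset Printing Implicit Defensive.

Import Order.TTheory GRing.Theory Num.Theory.
Import numFieldNormedType.Exports.

Local Open Scope classical_set_scope.
Local Open Scope ring_scope.

Section LinearAlgebra.
Context {R : realType}.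

(* A stacked vector of m blocks of height p lives in 'cV_(m * p); component i
   of block t has index mxtens_index (t, i), whose value is t * p + i. *)
Definition blockmx {m n p q : nat} (F : 'I_m -> 'I_n -> 'M[R]_(p, q)) :
    'M[R]_(m * p, n * q) :=
  \matrix_(r, c) F (mxtens_unindex r).1 (mxtens_unindex c).1
                   (mxtens_unindex r).2 (mxtens_unindex c).2.

Definition blockcol {m p n : nat} (F : 'I_m -> 'M[R]_(p, n)) :
    'M[R]_(m * p, n) :=
  \matrix_(r, c) F (mxtens_unindex r).1 (mxtens_unindex r).2 c.

Definition mxblk {m n p q : nat} (M : 'M[R]_(m * p, n * q))
    (t : 'I_m) (s : 'I_n) : 'M[R]_(p, q) :=
  \matrix_(i, j) M (mxtens_index (t, i)) (mxtens_index (s, j)).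

Definition colblk {m p n : nat} (M : 'M[R]_(m * p, n)) (t : 'I_m) :
    'M[R]_(p, n) :=
  \matrix_(i, j) M (mxtens_index (t, i)) j.

Definition dot {n : nat} (a b : 'cV[R]_n) : R := (a^T *m b) 0 0.

Definition psd {n : nat} (M : 'M[R]_n) : Prop :=
  M^T = M /\ forall z : 'cV[R]_n, 0 <= dot z (M *m z).

Definition posdef {n : nat} (M : 'M[R]_n) : Prop :=
  M^T = M /\ forall z : 'cV[R]_n, z != 0 -> 0 < dot z (M *m z).

Definition is_norm {n : nat} (nrm : 'cV[R]_n -> R) : Prop :=
  [/\ forall z, nrm z = 0 -> z = 0,
      forall (a : R) z, nrm (a *: z) = `|a| * nrm z
    & forall z1 z2, nrm (z1 + z2) <= nrm z1 + nrm z2].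

Definition dual_norm {n : nat} (nrm : 'cV[R]_n -> R) (a : 'cV[R]_n) : R :=
  sup [set dot a z | z in [set z | nrm z <= 1]].

End LinearAlgebra.

Definition borel_cV (R : realType) (n : nat) : measurableType _ :=
  g_sigma_algebraType (@open 'cV[R]_n).

Section Wasserstein.
Context {R : realType} {n : nat}.
Local Notation T := (borel_cV R n).
Local Open Scope ereal_scope.

Definition is_coupling (mu nu : set T -> \bar R)
    (Pi : probability (T * T)%type R) : Prop :=
  forall A : set T, measurable A ->
    Pi (fst @^-1` A) = mu A /\ Pi (snd @^-1` A) = nu A.

Definition wasserstein (nrm : 'cV[R]_n -> R) (mu nu : set T -> \bar R) :
    \bar R :=
  ereal_inf [set \int[Pi]_z (nrm (z.1 - z.2)%R)%:E | Pi in is_coupling mu nu].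

Definition empirical {Ns : nat} (xis : 'I_Ns -> 'cV[R]_n) (A : set T) :
    \bar R :=
  (Ns%:R^-1)%:E * \sum_(i < Ns) (\d_(xis i : T) A : \bar R).

End Wasserstein.

Record plant (R : realType) (nx nu ny nw : nat) := Plant {
  pA : 'M[R]_nx;
  pB : 'M[R]_(nx, nu);
  pC : 'M[R]_(nx, nw);
  pD : 'M[R]_(ny, nx);
  pE : 'M[R]_(ny, nw) }.

Record ambiguity (R : realType) (n q Ns : nat) := Ambiguity {
  aC : 'M[R]_(q, n);
  ad : 'cV[R]_q;
  anorm : 'cV[R]_n -> R;
  aeps : R;
  asample : 'I_Ns -> 'cV[R]_n }.

Record constraints (R : realType) (nx Nb : nat) := Constraints {
  cm : 'I_Nb -> 'I_nx;
  cU : 'I_Nb -> R }.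

Record weights (R : realType) (nx nu : nat) := Weights {
  wbeta : R;
  wQ : 'M[R]_nx;
  wQf : 'M[R]_nx;
  wR : 'M[R]_nu }.

Section Ambiguity.
Context {R : realType} {n q Ns : nat}.
Variable amb : ambiguity R n q Ns.
Local Notation T := (borel_cV R n).

Definition support_set : set 'cV[R]_n :=
  [set xi | forall i, (aC amb *m xi) i 0 <= ad amb i 0].

Definition ambiguity_ball : set (probability T R) :=
  [set Q : probability T R |
    [/\ (Q support_set = 1)%E,
        (\int[Q]_xi (anorm amb xi)%:E < +oo)%E
      & (wasserstein (anorm amb) (empirical (asample amb)) Q
          <= (aeps amb)%:E)%E]].

End Ambiguity.

Section Stacked.
Context {R : realType} {nx nu ny nw : nat} (sys : plant R nx nu ny nw) (N : nat).
Local Notation A := (pA sys).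
Local Notation B := (pB sys).
Local Notation C := (pC sys).
Local Notation D := (pD sys).
Local Notation E := (pE sys).

Definition stAx : 'M[R]_(N.+1 * nx, nx) :=
  blockcol (fun t : 'I_N.+1 => A ^+ t).

Definition stBx : 'M[R]_(N.+1 * nx, N * nu) :=
  blockmx (fun (t : 'I_N.+1) (s : 'I_N) =>
    if (s < t)%N then A ^+ (t - s.+1) *m B else 0).

Definition stCx : 'M[R]_(N.+1 * nx, N * nw) :=
  blockmx (fun (t : 'I_N.+1) (s : 'I_N) =>
    if (s < t)%N then A ^+ (t - s.+1) *m C else 0).

Definition stAy : 'M[R]_(N * ny, nx) :=
  blockcol (fun t : 'I_N => D *m A ^+ t).

Definition stCy : 'M[R]_(N * ny, N * nw) :=
  blockmx (fun t s : 'I_N =>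
    if (s < t)%N then D *m A ^+ (t - s.+1) *m C else 0).

Definition stEy : 'M[R]_(N * ny, N * nw) := (1%:M : 'M[R]_N) *t E.

(* [B_x]_{n_x+1 : (N+1)n_x, 1 : N n_u}; N.+1 * nx is convertible to
   nx + N * nx *)
Definition stBx_tail : 'M[R]_(N * nx, N * nu) :=
  dsubmx (stBx : 'M[R]_(nx + N * nx, N * nu)).

Definition tCx (x : 'cV[R]_nx) : 'M[R]_(N.+1 * nx, 1 + N * nw) :=
  row_mx (stAx *m x) stCx.

Definition tCy (x : 'cV[R]_nx) : 'M[R]_(1 + N * ny, 1 + N * nw) :=
  block_mx 0 0 (stAy *m x) stCy.

Definition tEy : 'M[R]_(1 + N * ny, 1 + N * nw) := block_mx 1%:M 0 0 stEy.

(* H_N = [h H] with H block lower triangular *)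
Definition is_policy (HN : 'M[R]_(N * nu, 1 + N * ny)) : Prop :=
  forall t tau : 'I_N, (t < tau)%N -> mxblk (rsubmx HN) t tau = 0.

Definition tH (x : 'cV[R]_nx) (HN : 'M[R]_(N * nu, 1 + N * ny)) :
    'M[R]_(N * nu, 1 + N * nw) :=
  HN *m (tCy x + tEy).

Definition state_mx (x : 'cV[R]_nx) (HN : 'M[R]_(N * nu, 1 + N * ny)) :
    'M[R]_(N.+1 * nx, 1 + N * nw) :=
  stBx *m tH x HN + tCx x.

Definition wtilde (xi : 'cV[R]_(N * nw)) : 'cV[R]_(1 + N * nw) :=
  col_mx 1%:M xi.

(* the predicted states x_{[k+1:k+N]} as a function of the disturbances *)
Definition predicted_states (x : 'cV[R]_nx) (HN : 'M[R]_(N * nu, 1 + N * ny))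
    (xi : 'cV[R]_(N * nw)) : 'cV[R]_(N * nx) :=
  dsubmx (state_mx x HN *m wtilde xi : 'cV[R]_(nx + N * nx)).

(* First input of the window: \hat y_k = 0, so v_k = y_k = D x_k + E w_k and
   u_k = h_k + H_{k,k} v_k. *)
Definition first_input (hN : (0 < N)%N) (HN : 'M[R]_(N * nu, 1 + N * ny))
    (x : 'cV[R]_nx) (w : 'cV[R]_nw) : 'cV[R]_nu :=
  colblk (lsubmx HN) (Ordinal hN)
  + mxblk (rsubmx HN) (Ordinal hN) (Ordinal hN) *m (D *m x + E *m w).

Definition next_state (x : 'cV[R]_nx) (u : 'cV[R]_nu) (w : 'cV[R]_nw) :
    'cV[R]_nx :=
  A *m x + B *m u + C *m w.

End Stacked.

Lemma colblkD (R : realType) m p n (X Y : 'M[R]_(m * p, n)) t : colblk (X + Y) t = colblk X t + colblk Y t.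
Proof. by apply/matrixP=> i j; rewrite !mxE. Qed.

Lemma colblk_blockcol (R : realType) m p n r (F : 'I_m -> 'M[R]_(p, n)) (x : 'M[R]_(n, r)) t :
  colblk (blockcol F *m x) t = F t *m x.
Proof.
apply/matrixP => i j; rewrite !mxE; apply: eq_bigr => k _.
by rewrite mxE mxtens_indexK.
Qed.

Lemma colblk_blockmx (R : realType) m n p q r (F : 'I_m -> 'I_n -> 'M[R]_(p, q)) (u : 'M[R]_(n * q, r)) t :
  colblk (blockmx F *m u) t = \sum_s F t s *m colblk u s.
Proof.
apply/matrixP => i j; rewrite summxE !mxE.
transitivity (\sum_s \sum_c F t s i c * u (mxtens_index (s, c)) j); last first.
  by apply: eq_bigr => s _; rewrite mxE; apply: eq_bigr => c _; rewrite mxE.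
rewrite pair_big (reindex (@mxtens_index n q)) /=; last first.
  by exists (@mxtens_unindex n q) => z _; rewrite ?mxtens_indexK ?mxtens_unindexK.
by apply: eq_bigr => [[s c] _]; rewrite mxE !mxtens_indexK.
Qed.

Lemma conv_step (R : realType) nx q N (A : 'M[R]_nx) (B : 'M[R]_(nx, q)) (u : 'M[R]_(N * q, 1)) (t : 'I_N) :
  \sum_(s < N) (if (s < t.+1)%N then A ^+ (t.+1 - s.+1) *m B else 0) *m colblk u s
  = A *m (\sum_(s < N) (if (s < t)%N then A ^+ (t - s.+1) *m B else 0) *m colblk u s)
    + B *m colblk u t.
Proof.
rewrite mulmx_sumr (bigD1 t) //= ltnSn subnn expr0 mul1mx addrC; congr (_ + _).
rewrite [RHS](bigD1 t) //= ltnn mul0mx mulmx0 add0r.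
apply: eq_bigr => s nst.
rewrite ltnS leq_eqVlt (inj_eq val_inj) (negPf nst) /=.
case: ifP => st; last by rewrite !mul0mx mulmx0.
by rewrite subSn // exprS !mulmxA.
Qed.

Section StackedTheory.
Context (R : realType) (nx nu ny nw N : nat) (sys : plant R nx nu ny nw).
Variables (x : 'cV[R]_nx).

Lemma stacked_statesE (u : 'cV[R]_(N * nu)) (xi : 'cV[R]_(N * nw)) (t : 'I_N) :
  let X := stAx sys N *m x + stBx sys N *m u + stCx sys N *m xi in
  colblk X ord0 = x /\
  colblk X (lift ord0 t) =
    next_state sys (colblk X (widen_ord (leqnSn N) t)) (colblk u t) (colblk xi t).
Proof.
rewrite /= !colblkD !colblk_blockcol !colblk_blockmx; split.
  by rewrite expr0 mul1mx !big1 ?addr0 // => s _; rewrite ltn0 mul0mx.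
rewrite /next_state /= /bump leq0n add1n !conv_step !mulmxDr exprS -[_ * _ *m x]mulmxA.
rewrite -!addrA; congr (_ + _); congr (_ + _); exact: addrCA.
Qed.

(* \tilde H_N \tilde w = h + H v with v the stacked purified outputs; purifiedE
   identifies v_t as D (x_t - \hat x_t) + E w_t, the contribution of the input
   to x_t being that of the nominal model started at 0. *)
Lemma stacked_inputE (HN : 'M[R]_(N * nu, 1 + N * ny)) (xi : 'cV[R]_(N * nw)) :
  tH sys x HN *m wtilde xi = lsubmx HN +
    rsubmx HN *m (stAy sys N *m x + (stCy sys N + stEy sys N) *m xi).
Proof.
rewrite /tH /tCy /tEy /wtilde -{1}(hsubmxK HN) -mulmxA add_block_mx !add0r addr0.
by rewrite mul_block_col mul_row_col ?mulmx1 mul0mx addr0 mulmx1.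
Qed.

Lemma purifiedE (xi : 'cV[R]_(N * nw)) (t : 'I_N) :
  colblk (stAy sys N *m x + (stCy sys N + stEy sys N) *m xi) t =
  pD sys *m colblk (stAx sys N *m x + stCx sys N *m xi) (widen_ord (leqnSn N) t)
  + pE sys *m colblk xi t.
Proof.
rewrite mulmxDl !colblkD !colblk_blockcol !colblk_blockmx mulmxDr mulmxA addrA.
congr (_ + _); first congr (_ + _).
  rewrite mulmx_sumr; apply: eq_bigr => s _ /=.
  by case: ifP; rewrite ?mul0mx ?mulmx0 // !mulmxA.
have -> : stEy sys N = blockmx (fun t s => (1%:M : 'M[R]_N) t s *: pE sys).
  by apply/matrixP => i j; rewrite !mxE.
rewrite colblk_blockmx (bigD1 t) //= big1 ?addr0 => [|s nst].
  by rewrite mxE eqxx scale1r.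
by rewrite mxE eq_sym (negPf nst) scale0r mul0mx.
Qed.

Lemma first_inputE (hN : (0 < N)%N) (HN : 'M[R]_(N * nu, 1 + N * ny)) (xi : 'cV[R]_(N * nw)) :
  is_policy HN ->
  colblk (tH sys x HN *m wtilde xi) (Ordinal hN) =
  first_input sys hN HN x (colblk xi (Ordinal hN)).
Proof.
move=> pol; rewrite stacked_inputE colblkD; congr (_ + _).
set v := (X in rsubmx HN *m X).
have {1}-> : rsubmx HN = blockmx (fun t s => mxblk (rsubmx HN) t s).
  by apply/matrixP => i j; rewrite [RHS]mxE [RHS]mxE -2!surjective_pairing !mxtens_unindexK.
rewrite colblk_blockmx (bigD1 (Ordinal hN)) //= big1 ?addr0 => [|s ns]; last first.
  by rewrite pol ?mul0mx //= lt0n; apply: contra ns => /eqP s0; apply/eqP/val_inj.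
congr (_ *m _).
rewrite /v purifiedE; congr (_ *m _ + _).
rewrite colblkD colblk_blockcol colblk_blockmx /= expr0 mul1mx big1 ?addr0 // => s _.
by rewrite mul0mx.
Qed.

Lemma dsubmx_colE (M : 'cV[R]_(N.+1 * nx)) (t : 'I_N) (i : 'I_nx) :
  (dsubmx (M : 'cV[R]_(nx + N * nx))) (mxtens_index (t, i)) 0 =
  M (mxtens_index (lift ord0 t, i)) 0.
Proof.
rewrite mxE; congr (M _ _); apply: val_inj => /=.
by rewrite /bump leq0n add1n mulSn addnA.
Qed.
End StackedTheory.

Section OptimalControl.
Context {R : realType} {nx nu ny nw : nat} (sys : plant R nx nu ny nw) (N : nat).
Context {q Ns Nb : nat}.
Variables (amb : ambiguity R (N * nw) q Ns) (con : constraints R nx Nb).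

(* Extended-real maximum, so that no default value is needed; it is finite as
   soon as 0 < N. *)
Definition state_loss (x : 'cV[R]_nx) (HN : 'M[R]_(N * nu, 1 + N * ny))
    (j : 'I_Nb) (xi : 'cV[R]_(N * nw)) : \bar R :=
  \big[maxe/-oo%E]_(i < N)
    (predicted_states sys x HN xi (mxtens_index (i, cm con j)) 0)%:E.

Definition dr_constraint (x : 'cV[R]_nx) (HN : 'M[R]_(N * nu, 1 + N * ny))
    (j : 'I_Nb) : Prop :=
  (ereal_sup [set \int[Q]_(xi in [set: borel_cV R (N * nw)])
                    state_loss x HN j xi | Q in ambiguity_ball amb]
    <= (cU con j)%:E)%E.

(* The set D(x); a state trajectory over the horizon is random, hence it is the
   map from disturbance sequences to predicted states. *)
Definition feasible_trajectories (x : 'cV[R]_nx) :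
    set ('cV[R]_(N * nw) -> 'cV[R]_(N * nx)) :=
  [set X | exists HN : 'M[R]_(N * nu, 1 + N * ny),
     [/\ is_policy HN, forall j, dr_constraint x HN j
       & X = predicted_states sys x HN]].

Definition feasible_until (W : set 'cV[R]_nw) (k : nat)
    (x : nat -> 'cV[R]_nx) : Prop :=
  (forall t, (t < k)%N -> exists u w,
     W w /\ x t.+1 = next_state sys (x t) u w) /\
  (forall t, (t <= k)%N -> feasible_trajectories (x t) !=set0).

Definition row_b (x : 'cV[R]_nx) (HN : 'M[R]_(N * nu, 1 + N * ny))
    (j : 'I_Nb) (t : 'I_N) : R :=
  state_mx sys x HN (mxtens_index (lift ord0 t, cm con j)) (lshift _ ord0).

Definition row_a (x : 'cV[R]_nx) (HN : 'M[R]_(N * nu, 1 + N * ny))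
    (j : 'I_Nb) (t : 'I_N) : 'cV[R]_(N * nw) :=
  \col_c state_mx sys x HN (mxtens_index (lift ord0 t, cm con j)) (rshift 1 c).

Definition CP_feasible (x : 'cV[R]_nx) (HN : 'M[R]_(N * nu, 1 + N * ny))
    (lam : 'I_Nb -> R) (s : 'I_Ns -> 'I_Nb -> R)
    (gam : 'I_Ns -> 'I_Nb -> 'I_N -> 'cV[R]_q) : Prop :=
  [/\ is_policy HN,
      forall j : 'I_Nb,
        lam j * aeps amb + Ns%:R^-1 * (\sum_(i < Ns) s i j) <= cU con j
    & forall (i : 'I_Ns) (j : 'I_Nb) (t : 'I_N),
    [/\ row_b x HN j t + dot (row_a x HN j t) (asample amb i)
          + dot (gam i j t) (ad amb - aC amb *m asample amb i) <= s i j,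
        dual_norm (anorm amb) ((aC amb)^T *m gam i j t - row_a x HN j t)
          <= lam j
      & forall l, 0 <= gam i j t l 0]].

Definition weightJx (wt : weights R nx nu) : 'M[R]_(N.+1 * nx) :=
  blockmx (fun t s : 'I_N.+1 =>
    if t == s then wbeta wt ^+ t *: (if (t < N)%N then wQ wt else wQf wt)
    else 0).

Definition weightJu (wt : weights R nx nu) : 'M[R]_(N * nu) :=
  diag_mx (\row_(t < N) wbeta wt ^+ t) *t wR wt.

Definition CP_cost (wt : weights R nx nu) (mu : 'cV[R]_(1 + N * nw))
    (Sigma : 'M[R]_(1 + N * nw)) (x : 'cV[R]_nx)
    (HN : 'M[R]_(N * nu, 1 + N * ny)) : R :=
  let X := tCx sys N x + stBx sys N *m tH sys x HN in
  let M := X^T *m weightJx wt *m X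
           + (tH sys x HN)^T *m weightJu wt *m tH sys x HN in
  \tr (M *m Sigma) + dot mu (M *m mu).

Definition CP_optimal_policy (wt : weights R nx nu)
    (mu : 'cV[R]_(1 + N * nw)) (Sigma : 'M[R]_(1 + N * nw)) (x : 'cV[R]_nx)
    (HN : 'M[R]_(N * nu, 1 + N * ny)) : Prop :=
  (exists lam s gam, CP_feasible x HN lam s gam) /\
  (forall HN' lam' s' gam', CP_feasible x HN' lam' s' gam' ->
     CP_cost wt mu Sigma x HN <= CP_cost wt mu Sigma x HN').

End OptimalControl.

Section Disturbance.
Context {d : measure_display} {Omega : measurableType d} {R : realType}
  (P : probability Omega R) {nw : nat}.
Variable w : nat -> Omega -> 'cV[R]_nw.

Definition iid_process : Prop :=
  [/\ forall t, measurable_fun [set: Omega] (w t : Omega -> borel_cV R nw),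
      forall t (S : set (borel_cV R nw)), measurable S ->
        P (w t @^-1` S) = P (w 0 @^-1` S)
    & forall (J : seq nat) (S : nat -> set (borel_cV R nw)), uniq J ->
        (forall t, measurable (S t)) ->
        fine (P (\bigcap_(t in [set` J]) (w t @^-1` S t))) =
        \prod_(t <- J) fine (P (w t @^-1` S t))].

Definition square_integrable : Prop :=
  forall t i, (fun o => w t o i 0) \in Lfun P 2%:E.

Definition wtilde_window (N k : nat) (o : Omega) : 'cV[R]_(1 + N * nw) :=
  wtilde (blockcol (fun t : 'I_N => w (k + t)%N o)).

Definition wtilde_mean (N k : nat) : 'cV[R]_(1 + N * nw) :=
  \col_i fine ('E_P[fun o => (wtilde_window N k o i 0)%R])%E.

Definition wtilde_cov (N k : nat) : 'M[R]_(1 + N * nw) :=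
  \matrix_(i, j) fine (covariance P (fun o => wtilde_window N k o i 0)
                                    (fun o => wtilde_window N k o j 0)).

End Disturbance.

(* Main.v *)
(* The offset [h] of a policy is unconstrained by causality. Since the
   block of [B_x] acting on the future states has full row rank, changing the
   initial state from [x] to [x'] can be compensated by [h] alone, leaving [H]
   unchanged: the predicted states are then the same function of the
   disturbances, so every policy feasible at [x] yields one feasible at any
   [x'], in particular at the successor of [x]. *)
Require Import Defs.
From mathcomp Require Import all_boot all_order all_algebra.
From mathcomp Require Import all_classical all_reals all_analysis.

Import Order.TTheory GRing.Theory Num.Theory.
Import numFieldNormedType.Exports.

Local Open Scope classical_set_scope.
Local Open Scope ring_scope.

(** Separates a summand constant in [xi], the only one containing the initial state and the offset
    [h], from a summand linear in [xi] that depends on the policy through [H] alone. *)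
Lemma predicted_statesE (R : realType) (nx nu ny nw N : nat)
    (sys : plant R nx nu ny nw) (x : 'cV[R]_nx)
    (HN : 'M[R]_(N * nu, 1 + N * ny)) (xi : 'cV[R]_(N * nw)) :
  predicted_states sys x HN xi =
    stBx_tail sys N *m (lsubmx HN + rsubmx HN *m (stAy sys N *m x))
    + dsubmx (stAx sys N *m x : 'cV[R]_(nx + N * nx))
    + (stBx_tail sys N *m (rsubmx HN *m ((stCy sys N + stEy sys N) *m xi))
       + dsubmx (stCx sys N *m xi : 'cV[R]_(nx + N * nx))).
Proof.
rewrite /predicted_states /state_mx mulmxDl -mulmxA stacked_inputE.
have -> : tCx sys N x *m wtilde xi = stAx sys N *m x + stCx sys N *m xi.
  by rewrite /tCx /wtilde mul_row_col mulmx1.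
rewrite /stBx_tail !mul_dsub_mx -!(linearD (@dsubmx R nx (N * nx) 1)) /=.
congr dsubmx; rewrite !mulmxDr !addrA; congr (_ + _).
by rewrite addrAC.
Qed.

Lemma predicted_states_transfer (R : realType) (nx nu ny nw N : nat)
    (sys : plant R nx nu ny nw) (x x' : 'cV[R]_nx)
    (HN : 'M[R]_(N * nu, 1 + N * ny)) :
  row_free (stBx_tail sys N) -> is_policy HN ->
  exists2 HN' : 'M[R]_(N * nu, 1 + N * ny),
    is_policy HN' & predicted_states sys x' HN' = predicted_states sys x HN.
Proof.
move=> /row_freeP[Binv BK] pol.
(* [free z] is the response to [z] without input or disturbance; [goal] is the constant summand at
   [x], to be reproduced from [x']. *)
pose free z := dsubmx (stAx sys N *m z : 'cV[R]_(nx + N * nx)).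
pose goal := stBx_tail sys N *m (lsubmx HN + rsubmx HN *m (stAy sys N *m x))
             + free x.
(* The new offset solves [stBx_tail *m (h' + H *m (stAy *m x')) + free x' = goal] by means of the
   right inverse [Binv]. *)
exists (row_mx (Binv *m (goal - free x') - rsubmx HN *m (stAy sys N *m x'))
               (rsubmx HN)).
  by move=> t tau /pol; rewrite row_mxKr.
apply: funext => xi; rewrite !predicted_statesE row_mxKl row_mxKr.
by rewrite subrK (mulmxA _ Binv) BK mul1mx subrK.
Qed.

Theorem theorem5p1 (R : realType) (nx nu ny nw N q Ns Nb : nat)
  (hN : (0 < N)%N) (hNs : (0 < Ns)%N)
  (sys : plant R nx nu ny nw)
  (d : measure_display) (Omega : measurableType d) (P : probability Omega R)
  (w : nat -> Omega -> 'cV[R]_nw) (W : set 'cV[R]_nw)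
  (hw_iid : iid_process P w) (hw_L2 : square_integrable P w)
  (hW : forall t o, W (w t o))
  (amb : ambiguity R (N * nw) q Ns)
  (hnorm : is_norm (anorm amb))
  (hpoly : bounded_set (support_set amb))
  (hsample : forall i, support_set amb (asample amb i))
  (heps : 0 < aeps amb)
  (con : constraints R nx Nb) (Im : {set 'I_nx})
  (hIm : forall j, cm con j \in Im)
  (wt : weights R nx nu)
  (hbeta : 0 < wbeta wt <= 1)
  (hQ : psd (wQ wt)) (hQf : psd (wQf wt)) (hR : posdef (wR wt))
  (hrank : (nx * N <= \rank (stBx_tail sys N))%N)
  (k : nat) (x : nat -> 'cV[R]_nx)
  (hx : feasible_until sys amb con W k x)
  (xhat : 'cV[R]_(N * nw) -> 'cV[R]_(N * nx))
  (hxhat : feasible_trajectories sys amb con (x k) xhat)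
  (HN : 'M[R]_(N * nu, 1 + N * ny))
  (hHN : CP_optimal_policy sys amb con wt
           (wtilde_mean P w N k) (wtilde_cov P w N k) (x k) HN) :
  forall wk : 'cV[R]_nw, W wk ->
    let xnext := next_state sys (x k) (first_input sys hN HN (x k) wk) wk in
    (exists HN' : 'M[R]_(N * nu, 1 + N * ny),
       is_policy HN' /\ forall j, dr_constraint sys amb con xnext HN' j) /\
    feasible_trajectories sys amb con xnext !=set0.
Proof.
move=> wk _ xnext.
(* The policy [H0] behind [xhat] satisfies the robust constraints themselves at [x k]; it is the one
   transferred to [xnext]. *)
case: hxhat => H0 [pol0 dr0 _].
have rowfree : row_free (stBx_tail sys N).
  by rewrite /row_free eqn_leq rank_leq_row (leq_trans _ hrank) // mulnC.
have [HN' pol' eqX] :=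
  @predicted_states_transfer _ _ _ _ _ _ sys (x k) xnext _ rowfree pol0.
have dr' j : dr_constraint sys amb con xnext HN' j.
  (* The loss sees the initial state and the policy only through [predicted_states], so both
     constraints are the same inequality. *)
  by move: (dr0 j); rewrite /dr_constraint /state_loss eqX.
by split; [exists HN' | exists (predicted_states sys xnext HN'), HN'].
Qed.
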